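(* For every fixed $\rho\in(0,1)$ there are constants $c_\rho>0$ and $\kappa_\rho<\infty$, independent of $d$, such that for all $d\ge2$ and all $\kappa\ge\kappa_\rho$, \[ \epsilon_{\mathrm G}(k')\le\rho\qquad\text{for every } k'\le c_\rho d\log_2\kappa. \] Consequently, there exist universal constants $c>0$ and $\kappa_0<\infty$ such that for all $d\ge2$ and all $\kappa\ge\kappa_0$, \[ C_{2,d}(\kappa)\ge c\,d\log_2\kappa. \]
   Context: For $d\ge1$, $\kappa\ge1$, let $\mathcal C_d(\kappa)=\{\mathcal N(0,\Sigma):\frac1\kappa I\preceq\Sigma\preceq I\}$ (covariance eigenvalues in $[1/\kappa,1]$), viewed as a channel whose input is an admissible covariance matrix and whose output is one sample $Y\sim\mathcal N(0,\Sigma)$. $\epsilon_{\mathrm G}(k')$ is the minimum achievable one-shot average decoding error for transmitting a $k'$-bit message over this channel: a code chooses covariances $\Sigma_1,\dots,\Sigma_{2^{k'}}$ with $\mathcal N(0,\Sigma_m)\in\mathcal C_d(\kappa)$, a uniform message $M$ is sent, $Y\sim\mathcal N(0,\Sigma_M)$ is observed, and $M$ is decoded from $Y$; the error is averaged over $M$. $C_{2,d}(\kappa)=\sup_\Pi I(\Theta;Y)$ (mutual information in bits), where the supremum is over prior distributions $\Pi$ of a random admissible covariance $\Sigma_\Theta$ and $Y\mid\Theta\sim\mathcal N(0,\Sigma_\Theta)$. *)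

(* Defs.v *)
From HB Require Import structures.
From mathcomp Require Import all_boot all_order all_algebra.
From mathcomp Require Import all_classical all_reals all_analysis.

Set Implicit Arguments.
Unset Strict Implicit.
Unset Printing Implicit Defensive.

Import Order.TTheory GRing.Theory Num.Theory.
Import numFieldNormedType.Exports.

Local Open Scope classical_set_scope.
Local Open Scope ring_scope.

Definition log2 (R : realType) (x : R) : R := ln x / ln 2.

Definition log2e (R : realType) (x : \bar R) : \bar R :=
  (lne x * ((ln 2)^-1)%:E)%E.

(* R^d with its product sigma-algebra *)
Notation rvec R d := (d.-tuple (measurableTypeR R)).

(* real d x d matrices with their Borel sigma-algebra *)
Notation borel_mx R d := (g_sigma_algebraType (@open 'M[R]_d)).

Section tuple_cons.
Context d (T : measurableType d) (n : nat).

Definition tuple_cons (p : T * n.-tuple T) : n.+1.-tuple T :=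
  [tuple of p.1 :: p.2].

Definition tuple_uncons (t : n.+1.-tuple T) : T * n.-tuple T :=
  (tnth t ord0, [tuple of behead t]).

Lemma tuple_consK : cancel tuple_cons tuple_uncons.
Proof. by move=> [x t]; congr pair; exact/val_inj. Qed.

Lemma measurable_tuple_cons : measurable_fun setT tuple_cons.
Proof. exact: measurable_cons. Qed.

Lemma measurable_tuple_uncons : measurable_fun setT tuple_uncons.
Proof.
by apply/measurable_fun_pairP; split;
  [exact: measurable_tnth|exact: measurable_behead].
Qed.

End tuple_cons.

Section cons_measure.
Local Open Scope ereal_scope.
Context d (T : measurableType d) (R : realType) (n : nat).
Variables (m1 : {sigma_finite_measure set T -> \bar R})
          (m2 : {sigma_finite_measure set (n.-tuple T) -> \bar R}).

Definition cons_measure (A : set (n.+1.-tuple T)) : \bar R :=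
  (m1 \x m2) (@tuple_cons _ T n @^-1` A).

Let preim_cons (A : set (n.+1.-tuple T)) :
  measurable A -> measurable (@tuple_cons _ T n @^-1` A).
Proof.
by move=> mA; rewrite -[X in measurable X]setTI; exact: measurable_tuple_cons.
Qed.

Let cons_measure0 : cons_measure set0 = 0.
Proof. by rewrite /cons_measure preimage_set0 measure0. Qed.

Let cons_measure_ge0 A : 0 <= cons_measure A.
Proof. exact: measure_ge0. Qed.

Let cons_measure_sigma_additive : semi_sigma_additive cons_measure.
Proof.
move=> F mF tF mUF; rewrite /cons_measure preimage_bigcup.
apply: measure_semi_sigma_additive.
- by move=> k; exact: preim_cons.
- apply/trivIsetP => /= i j _ _ ij; rewrite -preimage_setI.
  by move/trivIsetP : tF => /(_ _ _ _ _ ij) ->//; rewrite preimage_set0.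
- by rewrite -preimage_bigcup; exact: preim_cons.
Qed.

HB.instance Definition _ := isMeasure.Build _ _ _ cons_measure
  cons_measure0 cons_measure_ge0 cons_measure_sigma_additive.

Let cons_measure_sigma_finite : sigma_finite setT cons_measure.
Proof.
have /sigma_finiteP[F [TF ndF Foo]] := sigma_finiteT m1.
have /sigma_finiteP[G [TG ndG Goo]] := sigma_finiteT m2.
exists (fun k => @tuple_uncons _ T n @^-1` (F k `*` G k)).
  rewrite -preimage_bigcup; apply/esym/seteqP; split => // t _ /=.
  have [i _ Fi] : (\bigcup_i F i) (tuple_uncons t).1 by rewrite -TF.
  have [j _ Gj] : (\bigcup_i G i) (tuple_uncons t).2 by rewrite -TG.
  exists (maxn i j) => //; split.
    by move: Fi; exact/subsetPset/ndF/leq_maxl.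
  by move: Gj; exact/subsetPset/ndG/leq_maxr.
move=> k; have [mF Fk] := Foo k; have [mG Gk] := Goo k; split.
  rewrite -[X in measurable X]setTI; apply: measurable_tuple_uncons => //.
  exact: measurableX.
rewrite /cons_measure -comp_preimage (_ : _ \o _ = id).
  by rewrite preimage_id product_measure1E// lte_mul_pinfty// ge0_fin_numE.
by apply/funext => p /=; rewrite tuple_consK.
Qed.

HB.instance Definition _ := Measure_isSigmaFinite.Build _ _ _ cons_measure
  cons_measure_sigma_finite.

End cons_measure.

(* Lebesgue measure on R^d, as the iterated product of the one-dimensional
   one *)
Fixpoint lebesgue_rvec (R : realType) (d : nat) :
    {sigma_finite_measure set (rvec R d) -> \bar R} :=
  match d with
  | 0 => \d_([tuple] : rvec R 0)
  | d'.+1 => cons_measure (@lebesgue_measure R) (lebesgue_rvec R d')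
  end.

Section gaussian.
Context (R : realType) (d : nat).
Implicit Types (S : 'M[R]_d).

Definition gaussian_pdf S (y : rvec R d) : R :=
  let v : 'rV[R]_d := \row_i tnth y i in
  (Num.sqrt ((2 * pi) ^+ d * \det S))^-1 *
  expR (- (v *m invmx S *m v^T) 0 0 / 2).

(* N(0, S), through its density with respect to Lebesgue measure on R^d; only
   meaningful for positive definite S *)
Definition gaussian S (A : set (rvec R d)) : \bar R :=
  (\int[lebesgue_rvec R d]_(y in A) (gaussian_pdf S y)%:E)%E.

Definition psd (A : 'M[R]_d) : Prop :=
  A^T = A /\ forall v : 'rV[R]_d, 0 <= (v *m A *m v^T) 0 0.

Definition loewner_le (A B : 'M[R]_d) : Prop := psd (B - A).

Definition admissible (kappa : R) (S : 'M[R]_d) : Prop :=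
  loewner_le (kappa^-1)%:M S /\ loewner_le S 1%:M.

End gaussian.

Section one_shot_coding.
Context (R : realType) (d k : nat).
Variable kappa : R.
Local Open Scope ereal_scope.

Definition is_code (c : 'I_(2 ^ k) -> 'M[R]_d) : Prop :=
  forall m, admissible kappa (c m).

Definition is_decoder (D : rvec R d -> 'I_(2 ^ k)) : Prop :=
  forall m, measurable (D @^-1` [set m]).

Definition avg_error (c : 'I_(2 ^ k) -> 'M[R]_d)
    (D : rvec R d -> 'I_(2 ^ k)) : \bar R :=
  (((2 ^ k)%N%:R : R)^-1)%:E *
  \sum_(m < 2 ^ k) gaussian (c m) [set y | D y != m].

(* Decoders are deterministic: randomisation does not lower the minimal average
   error, since the average error is affine in the decoding rule. *)
Definition eps_G : \bar R :=
  ereal_inf [set e | exists c D,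
    [/\ is_code c, is_decoder D & e = avg_error c D]].

End one_shot_coding.

HB.instance Definition _ d1 d2 (X : measurableType d1) (Y : measurableType d2) :=
  isMeasurableFun.Build _ _ (X * Y)%type X fst measurable_fst.
HB.instance Definition _ d1 d2 (X : measurableType d1) (Y : measurableType d2) :=
  isMeasurableFun.Build _ _ (X * Y)%type Y snd measurable_snd.

Section mutual_information.
Local Open Scope ereal_scope.

Definition kl_div d (T : measurableType d) (R : realType)
    (P Q : probability T R) : \bar R :=
  if `[< P `<< Q >] then
    \int[P]_x log2e (Radon_Nikodym (charge_of_finite_measure P) Q x)
  else +oo.

Context d1 d2 (X : measurableType d1) (Y : measurableType d2) (R : realType).

Definition marginals_product (P : probability (X * Y)%type R) :
    probability (X * Y)%type R :=
  distribution P fst \x distribution P snd.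

(* I(X; Y) in bits, for (X, Y) with joint law P *)
Definition mutual_info (P : probability (X * Y)%type R) : \bar R :=
  kl_div P (marginals_product P).

End mutual_information.

Section capacity.
Context (R : realType) (d : nat).
Variable kappa : R.
Local Open Scope ereal_scope.

Definition is_prior (Pi : probability (borel_mx R d) R) : Prop :=
  Pi [set S | admissible kappa S] = 1.

(* P is the law of (Theta, Y) with Theta of law Pi and Y | Theta ~ N(0, Theta);
   P is determined by its values on measurable rectangles. *)
Definition is_joint_law (Pi : probability (borel_mx R d) R)
    (P : probability (borel_mx R d * rvec R d)%type R) : Prop :=
  forall A B, measurable A -> measurable B ->
    P (A `*` B) = \int[Pi]_(S in A) gaussian S B.

Definition capacity : \bar R :=
  ereal_sup [set I | exists Pi P,
    [/\ is_prior Pi, is_joint_law Pi P & I = mutual_info P]].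

End capacity.

Arguments capacity {R} d kappa.
Arguments eps_G {R} d k kappa.

(* Main.v *)
(* Split the d coordinates into n = d/2 pairs (X, a X + noise) with
   X ~ N(0, 1/4) and noise variance 4/kappa. The ratio of the two coordinates
   reveals the slope a up to about kappa^(-1/2), so each pair carries one of
   M = 2^q slopes with q of order log2 kappa and a small error probability
   delta. A Gilbert-Varshamov code of relative distance 1/4 over the alphabet of
   slopes corrects n/8 wrong pairs, and by Markov's inequality more than n/8 pairs
   are wrong with probability at most 8 delta; no independence is needed.
   For the capacity, take the uniform prior on such a code with error 1/2 and
   compare the joint law with the product of its marginals on the event that
   decoding succeeds, as in Fano's inequality. *)
Require Import Defs.
From HB Require Import structures.
From mathcomp Require Import all_boot all_order all_algebra.
From mathcomp Require Import all_classical all_reals all_analysis.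
From mathcomp Require Import measurable_realfun ring lra zify.

Set Implicit Arguments.
Unset Strict Implicit.
Unset Printing Implicit Defensive.

Import Order.TTheory GRing.Theory Num.Theory.
Import numFieldNormedType.Exports.

(** * Gilbert-Varshamov codes *)

Definition hamming n (T : finType) (v w : {ffun 'I_n -> T}) : nat :=
  \sum_(i < n) (v i != w i).

(** A word of the ball agrees with [v] outside a set [S] of at most [r] positions. There are at most
    [2 ^ n] such sets, and each allows at most [#|T| ^ r] words. *)
Lemma card_hamming_ball n r (T : finType) (v : {ffun 'I_n -> T}) : (0 < #|T|)%N ->
  (#|[set w | (hamming v w <= r)%N]| <= 2 ^ n * #|T| ^ r)%N.
Proof.
move=> T0.
pose F (S : {set 'I_n}) :=
  [set w : {ffun 'I_n -> T} | [forall i, (i \in S) || (w i == v i)]].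
have cardF (S : {set 'I_n}) : (#|S| <= r)%N -> (#|F S| <= #|T| ^ r)%N.
  move=> Sr; rewrite (@eq_card _ _ (family (fun i =>
      if i \in S then [pred _ : T | true] else pred1 (v i)))); last first.
    move=> w; rewrite !inE; apply/forallP/familyP => h i; move: (h i);
      by case: ifPn.
  rewrite card_family foldrE big_map big_enum/=.
  rewrite (eq_bigr (fun i => if i \in S then #|T| else 1%N)); last first.
    by move=> i _; case: ifP => _; [exact: eq_card|rewrite card1].
  by rewrite -big_mkcond/= prod_nat_const leq_pexp2l.
have sub : [set w | (hamming v w <= r)%N] \subset
    \bigcup_(S : {set 'I_n} | (#|S| <= r)%N) F S.
  apply/fintype.subsetP => w; rewrite inE => vw.
  apply/bigcupP; exists [set i | v i != w i].
    by rewrite -sum1dep_card big_mkcond/=; apply: leq_trans vw; apply: leq_sum => i _; case: (v i == w i).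
  by rewrite inE; apply/forallP => i; rewrite inE eq_sym; case: eqP.
apply: leq_trans (subset_leq_card sub) _.
have card_cup : (#|\bigcup_(S : {set 'I_n} | (#|S| <= r)%N) F S| <=
    \sum_(S : {set 'I_n} | (#|S| <= r)%N) #|F S|)%N.
  elim/big_ind2 : _ => [|A a B b Aa Bb|//]; first by rewrite cards0.
  by rewrite (leq_trans (leq_card_setU _ _))// leq_add.
apply: (leq_trans card_cup).
apply: (@leq_trans (\sum_(S : {set 'I_n} | (#|S| <= r)%N) #|T| ^ r)%N).
  by apply: leq_sum => S; exact: cardF.
rewrite sum_nat_const leq_mul2r; apply/orP; right.
by rewrite (leq_trans (max_card _))// -cardsT -powersetT card_powerset cardsT card_ord.
Qed.

Lemma hamming_sym n (T : finType) (v w : {ffun 'I_n -> T}) :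
  hamming v w = hamming w v.
Proof. by apply: eq_bigr => i _; rewrite eq_sym. Qed.

(** Relative distance at least 1/4, in integer form, and boolean so that a largest such code can be
    selected. *)
Definition distance_separated n (T : finType) (C : {set {ffun 'I_n -> T}}) :=
  [forall v in C, forall w in C, (v != w) ==> (n <= 4 * hamming v w)%N].

(* Gilbert-Varshamov: the balls around the words of a maximal code cover the
   whole space. *)
Lemma gilbert_varshamov n (T : finType) : (0 < n)%N -> (0 < #|T|)%N ->
  exists2 C : {set {ffun 'I_n -> T}}, distance_separated C &
    (#|T| ^ n <= #|C| * (2 ^ n * #|T| ^ (n %/ 4)))%N.
Proof.
move=> n0 T0.
have sep0 : distance_separated (finset.set0 : {set {ffun 'I_n -> T}}).
  by apply/forall_inP => v; rewrite inE.
case: (@arg_maxnP _ finset.set0 (@distance_separated n T) (fun C => #|C|) sep0) => C sepC maxC.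
exists C => //.
have cover w : exists2 v, v \in C & (4 * hamming v w < n)%N.
  have [wC|wC] := boolP (w \in C).
    by exists w => //; rewrite /hamming big1 ?muln0// => i _; rewrite eqxx.
  apply/exists_inP; apply: contraNT wC => /exists_inPn far.
  (* A word far from all of [C] could be added to [C], against maximality. *)
  suff /maxC : distance_separated (w |: C).
    by rewrite cardsU1; case: (w \in C) => //=; rewrite add1n ltnn.
  apply/forall_inP => u; rewrite !inE => uC; apply/forall_inP => v.
  rewrite !inE => vC; apply/implyP => uv; move: uC vC uv.
  move=> /predU1P[->|uC] /predU1P[->|vC]; first by rewrite eqxx.
  - by move=> _; rewrite hamming_sym leqNgt far.
  - by move=> _; rewrite leqNgt far.
  - by move: sepC => /forall_inP/(_ _ uC)/forall_inP/(_ _ vC)/implyP.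
have -> : (#|T| ^ n)%N = #|[set: {ffun 'I_n -> T}]|.
  by rewrite cardsT card_ffun card_ord.
pose B v := [set w : {ffun 'I_n -> T} | (hamming v w <= n %/ 4)%N].
have sub : [set: {ffun 'I_n -> T}] \subset \bigcup_(v in C) B v.
  apply/fintype.subsetP => w _; have [v vC vw] := cover w.
  by apply/bigcupP; exists v => //; rewrite inE leq_divRL// mulnC ltnW.
apply: leq_trans (subset_leq_card sub) _.
have card_cup : (#|\bigcup_(v in C) B v| <= \sum_(v in C) #|B v|)%N.
  elim/big_ind2 : _ => [|X a Y b Xa Yb|//]; first by rewrite cards0.
  by rewrite (leq_trans (leq_card_setU _ _))// leq_add.
apply: leq_trans card_cup _; rewrite -sum_nat_const; apply: leq_sum => v _.
exact: card_hamming_ball.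
Qed.

(** For an alphabet of size [2 ^ q] the Gilbert-Varshamov bound gives at least
    [2 ^ (q n - n - q (n %/ 4))] words. For [q >= 4] the exponent is at least [q n / 2], hence at
    least [k]. *)
Lemma exists_separated_code n q k : (0 < n)%N -> (4 <= q)%N ->
  (2 * k <= q * n)%N ->
  exists2 f : 'I_(2 ^ k) -> {ffun 'I_n -> 'I_(2 ^ q)}, injective f &
    forall l m, l != m -> (n <= 4 * hamming (f l) (f m))%N.
Proof.
move=> n0 q4 kqn.
have T0 : (0 < #|'I_(2 ^ q)|)%N by rewrite card_ord expn_gt0.
have [C sepC cardC] := gilbert_varshamov n0 T0.
have leC : (2 ^ k <= #|C|)%N.
  rewrite -(@leq_pmul2r (2 ^ n * (2 ^ q) ^ (n %/ 4))); last first.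
    by rewrite muln_gt0 !expn_gt0.
  move: cardC; rewrite card_ord; apply: leq_trans.
  rewrite -!expnM -!expnD leq_exp2l//.
  have := leq_trunc_div n 4; move: (n %/ 4) => t t4; nia.
have inC i : enum_val (widen_ord leC i) \in C := enum_valP _.
have inj : injective (fun i => enum_val (widen_ord leC i) : {ffun _ -> _}).
  by move=> i j /enum_val_inj/(congr1 val) /= ij; exact/val_inj.
exists (fun i => enum_val (widen_ord leC i)) => // l m lm.
move: sepC => /forall_inP/(_ _ (inC l))/forall_inP/(_ _ (inC m))/implyP; apply.
by rewrite (inj_eq inj).
Qed.

Local Open Scope classical_set_scope.
Local Open Scope ring_scope.

(** * Gaussian pairs *)

Section lebesgue_rvec.
Context (R : realType).
Local Open Scope ereal_scope.
Notation leb := (@lebesgue_measure R).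

Lemma integral_rvecS d (F : rvec R d.+1 -> \bar R) :
  measurable_fun [set: rvec R d.+1] F -> (forall y, 0 <= F y) ->
  \int[lebesgue_rvec R d.+1]_y F y =
  \int[leb]_x \int[lebesgue_rvec R d]_t F [tuple of x :: t].
Proof.
move=> mF F0.
have mC := @measurable_tuple_cons _ (measurableTypeR R) d.
transitivity (\int[pushforward (leb \x lebesgue_rvec R d)
    (@tuple_cons _ (measurableTypeR R) d)]_y F y).
  exact: eq_measure_integral.
rewrite ge0_integral_pushforward//= fubini_tonelli1//.
exact: measurableT_comp.
Qed.

Lemma integral_rvecSS d (F : rvec R d.+2 -> \bar R) :
  measurable_fun [set: rvec R d.+2] F -> (forall y, 0 <= F y) ->
  \int[lebesgue_rvec R d.+2]_y F y =
  \int[leb]_x \int[leb]_y \int[lebesgue_rvec R d]_t F [tuple of x :: y :: t].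
Proof.
move=> mF F0; rewrite integral_rvecS//; apply: eq_integral => x _.
rewrite (@integral_rvecS _ (fun t => F [tuple of x :: t])).
- by apply: eq_integral => y _; apply: eq_integral => t _; congr F; exact/val_inj.
- by apply: measurableT_comp => //; exact: measurable_cons.
- by move=> t; exact: F0.
Qed.

Lemma integral_rvec0 (F : rvec R 0 -> \bar R) :
  measurable_fun [set: rvec R 0] F ->
  \int[lebesgue_rvec R 0]_y F y = F [tuple].
Proof. by move=> mF /=; rewrite integral_dirac// diracT mul1e. Qed.

End lebesgue_rvec.

(** * Covariances of independent correlated pairs *)

Section slope_cov.
Context (R : realType).

Lemma quad_block_diag m n (A : 'M[R]_m) (C : 'M[R]_n) (u : 'rV_m) (v : 'rV_n) :
  (row_mx u v *m (block_mx A 0 0 C : 'M[R]_(m + n)) *m (row_mx u v)^T) 0 0 =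
  (u *m A *m u^T) 0 0 + (v *m C *m v^T) 0 0.
Proof.
by rewrite mul_row_block !mulmx0 addr0 add0r tr_row_mx mul_row_col mxE.
Qed.

Lemma psd_block_diag m n (A : 'M[R]_m) (C : 'M[R]_n) :
  psd A -> psd C -> psd (block_mx A 0 0 C : 'M[R]_(m + n)).
Proof.
move=> [tA qA] [tC qC]; split; first by rewrite tr_block_mx !trmx0 tA tC.
by move=> v; rewrite -[v]hsubmxK quad_block_diag addr_ge0.
Qed.

Lemma loewner_le_block_diag m n (A A' : 'M[R]_m) (C C' : 'M[R]_n) :
  loewner_le A A' -> loewner_le C C' ->
  loewner_le (block_mx A 0 0 C : 'M[R]_(m + n)) (block_mx A' 0 0 C').
Proof.
rewrite /loewner_le opp_block_mx add_block_mx !oppr0 !addr0.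
exact: psd_block_diag.
Qed.

Definition mx2 (p q r : R) : 'M[R]_2 :=
  \matrix_(i, j) if i != j then q else if i == 0 then p else r.

Definition rv2 (x y : R) : 'rV[R]_2 := \row_i if i == 0 then x else y.

Lemma rv2E (u : 'rV[R]_2) : u = rv2 (u 0 0) (u 0 1).
Proof.
apply/rowP => i; rewrite mxE; case: (eqVneq i 0) => [->//|i0].
by congr (u _ _); apply/val_inj; move: i i0 => [[|[|//]]].
Qed.

Lemma quad_mx2 p q r x y :
  (rv2 x y *m mx2 p q r *m (rv2 x y)^T) 0 0 =
  p * x ^+ 2 + 2 * q * x * y + r * y ^+ 2.
Proof. by rewrite !mxE !big_ord_recr big_ord0/= !mxE !big_ord_recr !big_ord0/= !mxE/=; ring. Qed.

Lemma psd_mx2 p q r : (forall x y, 0 <= p * x ^+ 2 + 2 * q * x * y + r * y ^+ 2) ->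
  psd (mx2 p q r).
Proof.
move=> h; split; last by move=> v; rewrite (rv2E v) quad_mx2.
by apply/matrixP => i j; rewrite !mxE eq_sym; case: (eqVneq i j) => [->|].
Qed.

Lemma det_mx2 p q r : \det (mx2 p q r) = p * r - q ^+ 2.
Proof.
rewrite (expand_det_row _ 0) !big_ord_recl big_ord0 /cofactor !det_mx11 !mxE/=.
by rewrite addr0 expr0 expr1; ring.
Qed.

Lemma invmx_mx2 p q r : p * r - q ^+ 2 != 0 ->
  invmx (mx2 p q r) = (p * r - q ^+ 2)^-1 *: mx2 r (- q) p.
Proof.
move=> D0; have u : mx2 p q r \in unitmx by rewrite unitmxE det_mx2 unitfE.
apply: (can_inj (mulKmx u)); rewrite mulmxV//.
apply/matrixP => i j; rewrite !mxE !big_ord_recr big_ord0/= !mxE.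
by move: i j => [[|[|//]]/= ?] [[|[|//]]/= ?]; rewrite ?mxE/=; field.
Qed.

(* The covariance of independent pairs [(X, a X + 2 sqrt e Z)] with
   [X ~ N(0, 1/4)] and [Z ~ N(0, 1)], the slope of the i-th pair being [a i]; a
   last unpaired coordinate has unit variance. *)
Fixpoint slope_cov (e : R) (a : nat -> R) (d : nat) : 'M[R]_d :=
  match d return 'M[R]_d with
  | d'.+2 => block_mx (mx2 4^-1 (a 0%N / 4) (a 0%N ^+ 2 / 4 + 4 * e)) 0
               0 (slope_cov e (fun i => a i.+1) d') : 'M[R]_(2 + d')
  | _ => 1%:M
  end.

(** Both Loewner bounds are checked block by block, each 2 x 2 quadratic form being a combination of
    squares with nonnegative coefficients. In the upper bound the coefficient of [y ^+ 2] vanishes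
    at slope 1 and [kappa = 8], which is where the threshold 8 comes from. *)
Lemma admissible_slope_cov kappa a d : 8 <= kappa ->
  (forall i, 0 <= a i <= 1) -> admissible kappa (slope_cov kappa^-1 a d).
Proof.
move=> k8; have k0 : 0 < kappa by lra.
have : 0 < kappa^-1 <= 8^-1.
  by rewrite invr_gt0 k0 lef_pV2// posrE; lra.
rewrite /admissible; move: kappa^-1 => e {kappa k8 k0} /andP[e0 e8].
have psd1 n (c : R) : 0 <= c -> psd (c%:M : 'M[R]_n).
  move=> c0; split=> [|v]; first exact: tr_scalar_mx.
  rewrite mul_mx_scalar -scalemxAl mxE mulr_ge0// mxE sumr_ge0// => i _.
  by rewrite mxE -expr2 sqr_ge0.
have h1 n : loewner_le e%:M (1%:M : 'M[R]_n) /\ loewner_le (1%:M : 'M[R]_n) 1%:M.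
  by split; rewrite /loewner_le -raddfB; apply: psd1; lra.
have [n] := ubnP d; elim: n d a => // n IH [|[|d]] a dn a01; [exact: h1..|].
have [IH1 IH2] := IH d (fun i => a i.+1) (ltnW dn) (fun i => a01 i.+1).
have /andP[a0 a1] := a01 0%N.
have sc c : (c%:M : 'M[R]_d.+2) = block_mx (mx2 c 0 c) 0 0 (c%:M : 'M[R]_d) :> 'M[R]_(2 + d).
  rewrite [LHS](@scalar_mx_block _ 2 d); congr block_mx.
  by apply/matrixP => i j; rewrite !mxE; case: (eqVneq i j) => //= ->; case: ifP.
have sub2 p q r p' q' r' : mx2 p q r - mx2 p' q' r' = mx2 (p - p') (q - q') (r - r').
  by apply/matrixP => i j; rewrite !mxE; case: ifP => // _; case: ifP.
split; rewrite sc; apply: (@loewner_le_block_diag 2 d) => //;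
  rewrite /loewner_le sub2; apply: psd_mx2 => x y;
  move: (a 0%N) a0 a1 => {IH IH1 IH2 a01 sc}b b0 b1.
- rewrite subr0; have p0 : 0 < 4^-1 - e by lra.
  (* Multiplying by the leading coefficient completes the square without a division. *)
  rewrite -(pmulr_rge0 _ p0).
  rewrite (_ : _ * _ = ((4^-1 - e) * x + b / 4 * y) ^+ 2 +
     e * (3 / 4 - 3 * e - b ^+ 2 / 4) * y ^+ 2); last by field.
  have b2 : b ^+ 2 <= 1 by rewrite expr_le1.
  by rewrite addr_ge0 ?sqr_ge0// mulr_ge0 ?sqr_ge0// mulr_ge0//; lra.
- have b2 : b ^+ 2 <= 1 by rewrite expr_le1.
  rewrite (_ : _ + _ = b / 4 * (x - y) ^+ 2 + (3 / 4 - b / 4) * x ^+ 2 +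
     (1 - b ^+ 2 / 4 - 4 * e - b / 4) * y ^+ 2); last by field.
  by rewrite !addr_ge0// mulr_ge0 ?sqr_ge0//; lra.
Qed.

Lemma slope_cov_unit e a d : 0 < e -> slope_cov e a d \in unitmx.
Proof.
move=> e0; have [n] := ubnP d; elim: n d a => // n IH [|[|d]] a dn;
  [exact: unitmx1..|].
rewrite [slope_cov _ _ _]/= -[d.+2]/(2 + d)%N block_diag_mx_unit IH ?andbT; last exact: ltnW.
by rewrite unitmxE det_mx2 unitfE (_ : _ - _ = e) ?gt_eqF//; field.
Qed.

(** The off-diagonal entry of each block is a quarter of its slope. This keeps the atoms of the
    uniform prior distinct. *)
Lemma slope_cov_inj e a b d i : slope_cov e a d = slope_cov e b d ->
  (i < d./2)%N -> a i = b i.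
Proof.
have [n] := ubnP d; elim: n d a b i => // n IH [|[|d]] a b i dn //= E.
have /eq_block_mx[E1 _ _ E2] : block_mx _ _ _ _ = block_mx _ _ _ _ :> 'M[R]_(2 + d) := E.
case: i => [_|i id]; last exact: (IH d (fun i => a i.+1) (fun i => b i.+1)) (ltnW dn) E2 _.
by move/matrixP: E1 => /(_ 0 1); rewrite !mxE/= => /(mulIf _); apply; rewrite invr_eq0 pnatr_eq0.
Qed.

(** The first block has determinant [e], and completing the square in its inverse gives the chain
    rule: the density of X, times that of the second coordinate given X, times that of the remaining
    pairs. *)
Lemma gaussian_pdf_slope_cov e a d (x y : R) (t : rvec R d) : 0 < e ->
  gaussian_pdf (slope_cov e a d.+2) [tuple of x :: y :: t] =
  normal_pdf 0 2^-1 x * normal_pdf (a 0%N * x) (2 * Num.sqrt e) y *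
  gaussian_pdf (slope_cov e (fun i => a i.+1) d) t.
Proof.
move=> e0; have se0 : Num.sqrt e != 0 by rewrite gt_eqF// sqrtr_gt0.
rewrite !normal_pdfE ?invr_eq0 ?mulf_neq0//.
rewrite /gaussian_pdf /normal_peak /normal_fun.
have -> : \row_i tnth [tuple of x :: y :: t] i =
    row_mx (rv2 x y) (\row_i tnth t i) :> 'rV[R]_(2 + d).
  apply/rowP => i; rewrite !mxE; case: splitP => j ij; rewrite mxE.
    by rewrite (tnth_nth 0) ij/=; case: j {ij} => [[|[|//]]].
  by rewrite !(tnth_nth 0) ij.
set v := \row_i tnth t i; set C := slope_cov e _ d.
have uC : C \in unitmx by exact: slope_cov_unit.
set b := a 0%N.
have dB : 4^-1 * (b ^+ 2 / 4 + 4 * e) - (b / 4) ^+ 2 = e by field.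
rewrite [slope_cov _ _ _]/= -/C -/b.
have uS := @slope_cov_unit e a d.+2 e0.
rewrite (@invmx_block_diag _ 2 d)//.
rewrite (@det_ublock _ 2 d) det_mx2 dB invmx_mx2 dB ?gt_eqF//.
rewrite (@quad_block_diag 2 d) -scalemxAr -scalemxAl mxE quad_mx2.
rewrite -[d.+2]/(2 + d)%N exprD mulrACA sqrtrM; last first.
  by rewrite mulr_ge0 ?sqr_ge0 ?ltW.
set q := (v *m _ *m _) _ _.
rewrite invfM.
have -> : Num.sqrt ((2 * pi) ^+ 2 * e) = Num.sqrt (2^-1 ^+ 2 * pi *+ 2) *
   Num.sqrt ((2 * Num.sqrt e) ^+ 2 * pi *+ 2) :> R.
  rewrite -sqrtrM; last by rewrite mulrn_wge0// mulr_ge0 ?sqr_ge0 ?pi_ge0.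
  by congr Num.sqrt; rewrite !exprMn sqr_sqrtr ?ltW//; field.
rewrite invfM.
rewrite (_ : - _ / 2 = - (x - 0) ^+ 2 / (2^-1 ^+ 2 *+ 2) +
   - (y - b * x) ^+ 2 / ((2 * Num.sqrt e) ^+ 2 *+ 2) + - q / 2); last first.
  by rewrite exprMn sqr_sqrtr ?ltW//; field; rewrite gt_eqF.
rewrite !expRD; ring.
Qed.

Lemma measurable_gaussian_pdf d (S : 'M[R]_d) :
  measurable_fun [set: rvec R d] (gaussian_pdf S).
Proof.
apply: measurable_funM => //; apply: measurableT_comp => //.
apply: measurable_funM => //; apply: measurableT_comp => //.
under eq_fun => y.
  rewrite mxE; under eq_bigr => j _.
    rewrite mxE (_ : (\row_i _)^T j 0 = tnth y j); last by rewrite !mxE.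
    under eq_bigr => i _ do rewrite mxE.
    over.
  over.
apply: measurable_sum => j; apply: measurable_funM; last exact: measurable_tnth.
apply: measurable_sum => i; apply: measurable_funM => //; exact: measurable_tnth.
Qed.

Lemma gaussian_pdf_ge0 d (S : 'M[R]_d) y : 0 <= gaussian_pdf S y.
Proof. by rewrite mulr_ge0 ?expR_ge0// invr_ge0 sqrtr_ge0. Qed.

End slope_cov.

(** * Decoding errors *)

Section integral.
Context d (T : measurableType d) (R : realType) (mu : {measure set T -> \bar R}).
Local Open Scope ereal_scope.

(* The integral of a nonnegative function, measurable or not, is the supremum of
   the integrals of the simple functions below it. *)
Lemma ge0_le_integralW (D : set T) (f g : T -> \bar R) :
  (forall x, D x -> 0 <= f x) -> (forall x, D x -> f x <= g x) ->
  \int[mu]_(x in D) f x <= \int[mu]_(x in D) g x.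
Proof.
move=> f0 fg; rewrite !ge0_integralE//; last first.
  by move=> x Dx; exact: le_trans (f0 _ Dx) (fg _ Dx).
apply: le_ereal_sup => _ [h hf <-]; exists h => // x; apply: le_trans (hf x) _.
by rewrite /patch; case: ifPn => // /set_mem; exact: fg.
Qed.

Lemma ge0_integral_lincomb (f g : T -> R) (u v : R) :
  measurable_fun setT f -> measurable_fun setT g ->
  (forall x, 0 <= f x)%R -> (forall x, 0 <= g x)%R -> (0 <= u)%R -> (0 <= v)%R ->
  \int[mu]_x (u * f x + v * g x)%:E =
  u%:E * (\int[mu]_x (f x)%:E) + v%:E * (\int[mu]_x (g x)%:E).
Proof.
move=> mf mg f0 g0 u0 v0; under eq_integral do rewrite EFinD !EFinM.
rewrite ge0_integralD//.
- by rewrite !ge0_integralZl_EFin//;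
    [move=> x _; rewrite lee_fin|apply/measurable_EFinP|
     move=> x _; rewrite lee_fin|apply/measurable_EFinP].
- by move=> x _; rewrite mule_ge0 ?lee_fin.
- by apply: measurable_funeM; apply/measurable_EFinP.
- by move=> x _; rewrite mule_ge0 ?lee_fin.
- by apply: measurable_funeM; apply/measurable_EFinP.
Qed.

End integral.

Lemma ltn_half_doubleS (i n : nat) : (i < n./2 -> i.*2.+1 < n)%N.
Proof. lia. Qed.

(** * Probability of many bad pairs *)

Section bad_blocks.
Context (R : realType).
Variables (e M delta : R).
Hypotheses (e0 : 0 < e) (M0 : 0 < M) (delta0 : 0 < delta)
  (eM : 4096 * e * M ^+ 2 <= delta ^+ 3).
Notation leb := (@lebesgue_measure R).
(* [s] is the standard deviation of the noise; both [|X| < b] and a noise larger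
   than [b / (2 M)] have probability at most [delta / 2]. *)
Let s := 2 * Num.sqrt e.
Let b := delta / 4.

(* [|y / x - a| >= 1 / (2 M)], written so that [x = 0] is bad. *)
Definition bad (a x y : R) : bool := `|x| <= 2 * M * `|y - a * x|.

(** If neither slope were bad, [y] would be within [|x| / (2 M)] of both [a * x] and [a' * x], and
    the triangle inequality would give [|a - a'| < 1 / M]. *)
Lemma bad_separated a a' x y : M^-1 <= `|a - a'| -> bad a x y || bad a' x y.
Proof.
move=> aa'; rewrite /bad; case: leP => //= h1; rewrite leNgt; apply/negP => h2.
have : `|(a - a') * x| <= `|y - a * x| + `|y - a' * x|.
  rewrite (_ : _ * x = (y - a' * x) - (y - a * x)); last by ring.
  by rewrite [leRHS]addrC ler_normB.
have : M^-1 * `|x| <= `|(a - a') * x| by rewrite normrM ler_wpM2r.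
have : M^-1 * (2 * M * `|y - a * x| + 2 * M * `|y - a' * x|) < M^-1 * (`|x| + `|x|).
  by rewrite ltr_pM2l ?invr_gt0// ltrD.
rewrite -!mulrDr -!mulrA mulrCA (mulrA M^-1) mulVf ?gt_eqF// mul1r; lra.
Qed.

(* Half of the exponent is bounded by [exp (- z) <= 1 / (1 + z)], the other half
   is the density with twice the variance. *)
Lemma normal_pdf_tail (m t y : R) : 0 < t -> t <= `|y - m| ->
  normal_pdf m s y <= 32 * e / t ^+ 2 * normal_pdf m (Num.sqrt 2 * s) y.
Proof.
move=> t0 tm; have se0 : 0 < Num.sqrt e by rewrite sqrtr_gt0.
have s0 : 0 < s by rewrite mulr_gt0.
have r20 : 0 < Num.sqrt (2 : R) by rewrite sqrtr_gt0.
have r21 : Num.sqrt (2 : R) <= 2.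
  by rewrite -[leRHS]ger0_norm// -sqrtr_sqr ler_sqrt// expr2; lra.
rewrite !normal_pdfE ?mulf_neq0 ?gt_eqF// /normal_peak /normal_fun.
have s2E : s ^+ 2 = 4 * e by rewrite exprMn sqr_sqrtr ?ltW//; ring.
rewrite (_ : (Num.sqrt 2 * s) ^+ 2 = 2 * s ^+ 2); last by rewrite exprMn sqr_sqrtr.
rewrite (_ : Num.sqrt (2 * _ * _ *+ 2) = Num.sqrt 2 * Num.sqrt (s ^+ 2 * pi *+ 2));
  last by rewrite -sqrtrM//; congr Num.sqrt; ring.
rewrite (invfM (Num.sqrt 2)); set p := (Num.sqrt (s ^+ 2 * _ *+ 2))^-1; have p0 : 0 <= p by rewrite invr_ge0 sqrtr_ge0.
set z := (y - m) ^+ 2; have tz : t ^+ 2 <= z.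
  by rewrite -[z]real_normK ?num_real// ler_pXn2r ?nnegrE// ltW.
rewrite (_ : - z / (s ^+ 2 *+ 2) = - (z / (16 * e)) - z / (16 * e)); last first.
  by rewrite s2E; field; rewrite gt_eqF.
rewrite (_ : - z / (2 * s ^+ 2 *+ 2) = - (z / (16 * e))); last first.
  by rewrite s2E; field; rewrite gt_eqF.
rewrite expRD; set E := expR (- (z / _)); have E0 : 0 < E by exact: expR_gt0.
have t20 : 0 < t ^+ 2 by rewrite exprn_gt0.
have EE : E <= 16 * e / t ^+ 2.
  rewrite /E expRN -[leRHS]invrK lef_pV2 ?posrE ?expR_gt0 ?invr_gt0 ?divr_gt0 ?mulr_gt0//.
  apply: le_trans (expR_ge1Dx _); rewrite invfM invrK.
  apply: (@le_trans _ _ (z / (16 * e))); last by rewrite lerDr.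
  by rewrite mulrC ler_wpM2r// invr_ge0 mulr_ge0// ltW.
have ri : 1 <= 2 * (Num.sqrt 2)^-1 :> R by rewrite ler_pdivlMr// mul1r.
rewrite [leRHS](_ : _ = (32 * e / t ^+ 2 * (Num.sqrt 2)^-1) * (p * E)); last by ring.
rewrite [leLHS]mulrCA ler_wpM2r ?mulr_ge0 ?(ltW E0)//.
apply: le_trans EE _.
rewrite (_ : 32 * e * _ * _ = 16 * e / t ^+ 2 * (2 * (Num.sqrt 2)^-1)); last by ring.
by rewrite ler_peMr// mulr_ge0 ?invr_ge0 ?mulr_ge0 ?ltW.
Qed.

(** The peak is [1 / sqrt (pi / 2)] and [pi >= 2]. Hence X lies in an interval with probability at
    most its length. *)
Lemma normal_pdf_half_le1 x : normal_pdf 0 2^-1 x <= 1 :> R.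
Proof.
apply: le_trans (normal_pdf_ub _ _ _) _; first by rewrite invr_eq0.
rewrite /normal_peak invf_le1; last first.
  by rewrite sqrtr_gt0 mulrn_wgt0// mulr_gt0 ?pi_gt0// exprn_gt0.
rewrite -[leLHS]sqrtr1 ler_sqrt; last first.
  by rewrite mulrn_wge0// mulr_ge0 ?pi_ge0// exprn_ge0.
have := pi_ge2 R; rewrite expr2 -mulr_natr; lra.
Qed.

(** For [|x| < b] the density of X is bounded by 1. Otherwise a bad pair has noise at least
    [b / (2 M)], and the tail factor [32 e (2 M / b) ^ 2] is at most [delta / 2] by [eM]. The
    pointwise form leaves only normal densities and an indicator to integrate. *)
Lemma bad_bound a x y :
  normal_pdf 0 2^-1 x * normal_pdf (a * x) s y * (bad a x y)%:R <=
  \1_(`]-b, b[%classic) x * normal_pdf (a * x) s y +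
  delta / 2 * normal_pdf 0 2^-1 x * normal_pdf (a * x) (Num.sqrt 2 * s) y :> R.
Proof.
have p0 m t z : 0 <= normal_pdf m t z :> R := normal_pdf_ge0 m t z.
have b0 : 0 < b by rewrite divr_gt0.
rewrite indicE mem_setE /= in_itv/= -ltr_norml; case: ltP => [xb|bx].
  rewrite mul1r -[leLHS]addr0 lerD//; last by rewrite !mulr_ge0// ltW.
  rewrite mulrAC -[leRHS]mul1r ler_wpM2r//.
  by rewrite mulr_ile1// ?normal_pdf_half_le1//; case: bad.
rewrite mul0r add0r; case: (boolP (bad a x y)) => [xy|_]; last first.
  by rewrite mulr0 !mulr_ge0// ltW.
rewrite mulr1 -mulrA mulrCA ler_wpM2l//.
have t0 : 0 < b / (2 * M) by rewrite divr_gt0// mulr_gt0.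
apply: le_trans (normal_pdf_tail t0 _) _.
  by rewrite ler_pdivrMr ?mulr_gt0// mulrC (le_trans bx).
rewrite ler_wpM2r// ler_pdivrMr ?exprn_gt0// /b.
rewrite (_ : _ * _ ^+ 2 = delta ^+ 3 / (128 * M ^+ 2)); last by field; rewrite gt_eqF.
rewrite ler_pdivlMr ?mulr_gt0 ?exprn_gt0//.
by rewrite (_ : 32 * e * _ = 4096 * e * M ^+ 2)//; ring.
Qed.

(** [y] is a plain sequence, so that removing the first pair is a mere pattern match. The default
    [0] is never read on a sequence of size [d]. *)
Definition nbad (d : nat) (a : nat -> R) (y : seq R) : nat :=
  \sum_(i < d./2) bad (a i) (nth 0%R y i.*2) (nth 0%R y i.*2.+1).

Lemma nbadSS d a x y t :
  nbad d.+2 a [:: x, y & t] = (bad (a 0%N) x y + nbad d (fun i => a i.+1) t)%N.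
Proof. by rewrite /nbad /= big_ord_recl. Qed.

Lemma measurable_nbad d a : measurable_fun [set: rvec R d] (fun y => (nbad d a y)%:R : R).
Proof.
under eq_fun do rewrite natr_sum.
apply: measurable_sum => i.
have mnth j : (j < d)%N -> measurable_fun [set: rvec R d] (fun y : rvec R d => nth 0 y j).
  move=> jd; under eq_fun do rewrite -(tnth_nth 0 _ (Ordinal jd)).
  exact: measurable_tnth.
have id := ltn_ord i.
have id' := ltn_half_doubleS id.
have m1 := mnth _ (ltnW id').
have m2 := mnth _ id'.
apply: (@measurableT_comp _ _ _ _ _ _ (fun c : bool => c%:R : R)) => //.
apply: measurable_fun_ler.
  exact: measurableT_comp.
apply: measurable_funM => //; apply: measurableT_comp => //.
by apply: measurable_funB => //; exact: measurable_funM.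
Qed.

Local Open Scope ereal_scope.

(** Integrating out the remaining pairs, then the second coordinate, then the first, leaves a factor
    1 each time. *)
Lemma integral_gaussian_pdf_slope_cov d a :
  \int[lebesgue_rvec R d]_y (gaussian_pdf (slope_cov e a d) y)%:E = 1.
Proof.
have mg n (S : 'M[R]_n) : measurable_fun [set: rvec R n] (fun y => (gaussian_pdf S y)%:E).
  by apply/measurable_EFinP; exact: measurable_gaussian_pdf.
have g0 n (S : 'M[R]_n) y : 0 <= (gaussian_pdf S y)%:E.
  by rewrite lee_fin gaussian_pdf_ge0.
have [n] := ubnP d; elim: n d a => // n IH [|[|d]] a dn.
- rewrite integral_rvec0// /gaussian_pdf expr0 mul1r det_mx00 sqrtr1 invr1 mul1r.
  by rewrite thinmx0 mul0mx mxE oppr0 mul0r expR0.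
- rewrite integral_rvecS//; under eq_integral => x _.
    rewrite integral_rvec0; last first.
      apply: (@measurableT_comp _ _ _ _ _ _ (fun y : rvec R 1 => (gaussian_pdf (1%:M : 'M[R]_1) y)%:E)); first exact: mg.
      exact: measurable_cons.
    rewrite (_ : gaussian_pdf _ _ = normal_pdf 0 1 x); last first.
      rewrite normal_pdfE ?oner_neq0// /gaussian_pdf /normal_peak /normal_fun.
      rewrite [slope_cov _ _ _]/= det1 invmx1 mulmx1 mxE big_ord1 !mxE (tnth_nth 0%R)/= -expr2 subr0.
      by congr (_^-1 * expR _)%R; [congr Num.sqrt; ring|field].
    over.
  exact: integral_normal_pdf.
rewrite integral_rvecSS//.
rewrite -[RHS](integral_normal_pdf 0 2^-1); apply: eq_integral => x _.
rewrite -[RHS]mule1 -(integral_normal_pdf (a 0%N * x) s).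
rewrite -ge0_integralZl_EFin ?normal_pdf_ge0//; last 2 first.
- by move=> y _; rewrite lee_fin normal_pdf_ge0.
- by apply/measurable_EFinP; exact: measurable_normal_pdf.
apply: eq_integral => y _.
under eq_integral do rewrite gaussian_pdf_slope_cov// EFinM.
rewrite ge0_integralZl_EFin//; [|exact: mg|by rewrite mulr_ge0 ?normal_pdf_ge0].
by rewrite IH ?mule1 ?EFinM// ltnW.
Qed.

(** Linearity of expectation, by induction on the pairs: each pair is bad with probability at most
    [2 b + delta / 2 = delta]. *)
Lemma expected_nbad d a :
  \int[lebesgue_rvec R d]_y
    (gaussian_pdf (slope_cov e a d) y * (nbad d a y)%:R)%:E <= (d./2%:R * delta)%:E.
Proof.
have p0 m t z : (0 <= normal_pdf m t z :> R)%R := normal_pdf_ge0 m t z.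
have b0 : (0 < b)%R by rewrite divr_gt0.
have [n] := ubnP d; elim: n d a => // n IH [|[|d]] a dn.
- by under eq_integral do rewrite /nbad big_ord0 mulr0; rewrite integral0 mul0r.
- by under eq_integral do rewrite /nbad big_ord0 mulr0; rewrite integral0 mul0r.
rewrite integral_rvecSS; last 2 first.
- apply/measurable_EFinP; apply: measurable_funM; first exact: measurable_gaussian_pdf.
  exact: measurable_nbad.
- by move=> y; rewrite lee_fin mulr_ge0 ?gaussian_pdf_ge0.
(* [K] is the inductive bound for the remaining pairs, and [u] below dominates the contribution of
   the first pair. *)
set a' := fun i => a i.+1; set K := (d./2%:R * delta)%R.
have K0 : (0 <= K)%R by rewrite mulr_ge0 ?ler0n ?ltW.
pose phi := (normal_pdf 0 2^-1 : R -> R).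
have phi0 x : (0 <= phi x)%R by exact: p0.
pose u x y := (\1_(`]-b, b[%classic) x * normal_pdf (a 0%N * x) s y +
  delta / 2 * phi x * normal_pdf (a 0%N * x) (Num.sqrt 2 * s) y)%R.
have step1 x y : \int[lebesgue_rvec R d]_t
    (gaussian_pdf (slope_cov e a d.+2) [tuple of [:: x, y & t]] *
     (nbad d.+2 a [tuple of [:: x, y & t]])%:R)%:E <=
    (u x y + K * (phi x * normal_pdf (a 0%N * x) s y))%:E.
  apply: (@le_trans _ _ (\int[lebesgue_rvec R d]_t
    (u x y * gaussian_pdf (slope_cov e a' d) t +
     (phi x * normal_pdf (a 0%N * x) s y) *
       (gaussian_pdf (slope_cov e a' d) t * (nbad d a' t)%:R))%:E)).
    apply: ge0_le_integralW => t _; first by rewrite lee_fin mulr_ge0 ?gaussian_pdf_ge0.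
    rewrite lee_fin gaussian_pdf_slope_cov// nbadSS natrD mulrDr mulrA lerD//.
    by rewrite mulrAC ler_wpM2r ?gaussian_pdf_ge0// bad_bound.
  rewrite ge0_integral_lincomb//.
  - rewrite integral_gaussian_pdf_slope_cov mule1 [leRHS]EFinD leeD2l//.
    rewrite (mulrC K) [leRHS]EFinM lee_wpmul2l// ?lee_fin ?mulr_ge0//; apply: IH.
    exact: ltnW.
  - exact: measurable_gaussian_pdf.
  - by apply: measurable_funM; [exact: measurable_gaussian_pdf|exact: measurable_nbad].
  - by move=> t; exact: gaussian_pdf_ge0.
  - by move=> t; rewrite mulr_ge0 ?gaussian_pdf_ge0.
  - by rewrite addr_ge0 ?mulr_ge0// ltW.
  - by rewrite mulr_ge0.
have step2 x : \int[leb]_y (u x y + K * (phi x * normal_pdf (a 0%N * x) s y))%:E =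
    (1 * \1_(`]-b, b[%classic) x + (delta / 2 + K) * phi x)%:E.
  under eq_integral => y _.
    rewrite (_ : u x y + _ = (\1_(`]-b, b[%classic) x + K * phi x) * normal_pdf (a 0%N * x) s y +
      (delta / 2 * phi x) * normal_pdf (a 0%N * x) (Num.sqrt 2 * s) y)%R; last by rewrite /u; ring.
    over.
  rewrite ge0_integral_lincomb//.
  - by rewrite !integral_normal_pdf !mule1 -EFinD; congr EFin; ring.
  - exact: measurable_normal_pdf.
  - exact: measurable_normal_pdf.
  - by rewrite addr_ge0// mulr_ge0.
  - by rewrite mulr_ge0// mulr_ge0// ltW.
apply: (@le_trans _ _ (\int[leb]_x (1 * \1_(`]-b, b[%classic) x + (delta / 2 + K) * phi x)%:E)).
  apply: ge0_le_integralW => x _.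
    apply: integral_ge0 => y _; apply: integral_ge0 => t _.
    by rewrite lee_fin mulr_ge0 ?gaussian_pdf_ge0.
  rewrite -step2; apply: ge0_le_integralW => y _; last exact: step1.
  by apply: integral_ge0 => t _; rewrite lee_fin mulr_ge0 ?gaussian_pdf_ge0.
rewrite ge0_integral_lincomb//; last 2 first.
- exact: measurable_normal_pdf.
- by rewrite addr_ge0// mulr_ge0 ?ltW.
rewrite integral_normal_pdf mule1 mul1e integral_indic// setIT.
have lebb : lebesgue_measure `](- b)%R, b[%classic = (b + b)%:E.
  have := @lebesgue_measure_itv R `](- b)%R, b[.
  by rewrite /= lte_fin gtrN// -EFinB opprK.
rewrite [X in X + _]lebb.
have -> : (d.+2./2%:R = d./2%:R + 1 :> R)%R by rewrite natr1.
by rewrite -!EFinD lee_fin /K /b; lra.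
Qed.

(** Markov's inequality: on the event, [1 <= 8 nbad / d./2], and the expectation of [nbad] is at
    most [d./2 * delta]. *)
Lemma gaussian_many_bad d a : (2 <= d)%N ->
  gaussian (slope_cov e a d) [set y | (d./2 <= 8 * nbad d a y)%N] <=
  (8 * delta)%:E.
Proof.
move=> d2; have n0 : (0 < d./2%:R :> R)%R by rewrite ltr0n half_gt0.
rewrite /gaussian integral_mkcond.
apply: (@le_trans _ _ (\int[lebesgue_rvec R d]_y ((8 / d./2%:R)%:E *
  (gaussian_pdf (slope_cov e a d) y * (nbad d a y)%:R)%:E))).
  apply: ge0_le_integralW => y _; first by rewrite erestrict_ge0// => z _; rewrite lee_fin gaussian_pdf_ge0.
  rewrite patchE; case: ifPn => [/set_mem/= yA|_].
    rewrite lee_fin mulrCA ler_peMr ?gaussian_pdf_ge0//.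
    by rewrite mulrAC ler_pdivlMr// mul1r -natrM ler_nat.
  by rewrite -EFinM lee_fin !mulr_ge0 ?invr_ge0 ?gaussian_pdf_ge0.
rewrite ge0_integralZl_EFin//.
- apply: (@le_trans _ _ ((8 / d./2%:R)%:E * (d./2%:R * delta)%:E)).
    by rewrite lee_wpmul2l ?expected_nbad// lee_fin divr_ge0.
  by rewrite -EFinM lee_fin mulrA divfK ?gt_eqF.
- by move=> y _; rewrite lee_fin mulr_ge0 ?gaussian_pdf_ge0.
- apply/measurable_EFinP; apply: measurable_funM; first exact: measurable_gaussian_pdf.
  exact: measurable_nbad.
Qed.

End bad_blocks.

(** Points outside all the [A i] are sent to [i0]. So the preimage of [i0] is the complement of the
    union of the other sets, and every other preimage is [A i] itself. *)
Lemma disjoint_decoder d (T : measurableType d) (I : finType) (i0 : I)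
    (A : I -> set T) :
  (forall i, measurable (A i)) ->
  (forall i j y, A i y -> A j y -> i = j) ->
  exists D : T -> I, (forall i, measurable (D @^-1` [set i])) /\
    (forall i y, A i y -> D y = i).
Proof.
move=> mA dA; pose D y := odflt i0 [pick i | y \in A i].
have DA i y : A i y -> D y = i.
  rewrite /D => Ay; case: pickP => [j /set_mem Aj|/(_ i)]; first exact: dA Aj Ay.
  by rewrite mem_set.
exists D; split => // i; have [->|ii0] := eqVneq i i0; last first.
  rewrite (_ : _ @^-1` _ = A i)//; apply/seteqP; split=> [y /=|y /DA//].
  by rewrite /D; case: pickP => [j /set_mem Aj /= <-//|_ /= i0i]; move: ii0; rewrite -i0i eqxx.
rewrite (_ : _ @^-1` _ = ~` \bigcup_(j in [set j | j != i0]) A j).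
  by apply: measurableC; apply: fin_bigcup_measurable => [|j _]; [exact: finite_finset|exact: mA].
apply/seteqP; split => [y /= Dy [j /= ji0 /DA]|y /= h].
  by rewrite Dy => ji; rewrite ji eqxx in ji0.
rewrite /D; case: pickP => //= j /set_mem Aj; apply/eqP; apply: contrapT => /negP ji0.
by apply: h; exists j.
Qed.

(** * Slope codes and their rate *)

Section code.
(** Unique decoding: two words at distance at least [n / 4] cannot both explain an output with fewer
    than [n / 8] bad pairs. *)
Let leq_sep (n h b c : nat) :
  (n <= 4 * h -> h <= b + c -> 8 * b < n -> 8 * c < n -> false)%N.
Proof. lia. Qed.

Let leq_triple_half (n : nat) : (2 <= n -> n <= 3 * n./2)%N.
Proof. lia. Qed.

Context (R : realType).

Lemma le_gaussian d (S : 'M[R]_d) (A B : set (rvec R d)) : A `<=` B ->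
  (gaussian S A <= gaussian S B)%E.
Proof.
move=> AB; rewrite /gaussian [leLHS]integral_mkcond [leRHS]integral_mkcond.
apply: ge0_le_integralW => y _; rewrite !patchE.
  by case: ifP => //; rewrite lee_fin gaussian_pdf_ge0.
case: ifPn => [/set_mem/AB/mem_set ->//|_].
by case: ifP => //; rewrite lee_fin gaussian_pdf_ge0.
Qed.

(** Where the words differ, the slopes differ by at least [1 / M], since distinct integers differ by
    at least 1. By [bad_separated] the pair is then bad for one of the two. *)
Lemma hamming_le_nbad (M : nat) n (v w : {ffun 'I_n -> 'I_M})
    (a b : nat -> R) d (y : seq R) : d./2 = n ->
  (forall i : 'I_n, a i = (v i)%:R / M%:R) ->
  (forall i : 'I_n, b i = (w i)%:R / M%:R) ->
  (hamming v w <= nbad M%:R d a y + nbad M%:R d b y)%N.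
Proof.
move=> dn; subst n => av bw; rewrite /hamming /nbad -big_split/=.
apply: leq_sum => i _; rewrite av bw; have [//|vw] := eqVneq (v i) (w i).
have M0 : (0 < M)%N by case: M v {w av bw vw} => // v; case: (v i).
have MR : 0 < M%:R :> R by rewrite ltr0n.
have := @bad_separated R M%:R MR ((v i)%:R / M%:R) ((w i)%:R / M%:R)
  (nth 0 y i.*2) (nth 0 y i.*2.+1).
rewrite -mulrBl normrM normfV (ger0_norm (ltW MR)) ler_peMl ?invr_ge0 ?(ltW MR)//.
  by move=> /(_ isT); case: bad => //=; case: bad.
have : (v i)%:Z - (w i)%:Z != 0 :> int by rewrite subr_eq0 eqz_nat.
by rewrite -normr_gt0 gtz0_ge1 -(@ler_int R) intr_norm rmorphB.
Qed.

Lemma exists_slope_code (rho kappa : R) (d k q : nat) :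
  0 < rho -> 8 <= kappa -> (2 <= d)%N -> (4 <= q)%N -> (2 * k <= q * d./2)%N ->
  4096 * 2 ^+ q ^+ 2 <= kappa * (rho / 8) ^+ 3 ->
  exists (a : 'I_(2 ^ k) -> nat -> R) (D : rvec R d -> 'I_(2 ^ k)),
    [/\ is_code kappa (fun m => slope_cov kappa^-1 (a m) d), is_decoder D,
        injective (fun m => slope_cov kappa^-1 (a m) d) &
        forall m, (gaussian (slope_cov kappa^-1 (a m) d) [set y | D y != m] <=
                   rho%:E)%E].
Proof.
move=> rho0 k8 d2 q4 kq large; have k0 : 0 < kappa by lra.
have n0 : (0 < d./2)%N by rewrite half_gt0.
have [f finj fsep] := exists_separated_code n0 q4 kq.
pose M := (2 ^ q)%N; have M0 : 0 < M%:R :> R by rewrite ltr0n expn_gt0.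
(* The slopes are multiples of [1 / M] in [0, 1), extended by 0 past the last pair. *)
pose a m i : R := if insub i is Some j then (f m j)%:R / M%:R else 0.
have aE m (i : 'I_d./2) : a m i = (f m i)%:R / M%:R by rewrite /a valK.
have e0 : 0 < kappa^-1 by rewrite invr_gt0.
have delta0 : 0 < rho / 8 by rewrite divr_gt0.
have eM : 4096 * kappa^-1 * M%:R ^+ 2 <= (rho / 8) ^+ 3.
  by rewrite natrX mulrAC ler_pdivrMr// [leRHS]mulrC.
(* The decoding region of [m]; the distance of the code makes these regions disjoint. *)
pose A m := [set y : rvec R d | (8 * nbad M%:R d (a m) y < d./2)%N].
have mA m : measurable (A m).
  have := @measurable_nbad R M%:R d (a m).
  move=> /(_ measurableT _ (measurable_itv `]-oo, (d./2%:R / 8)[)).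
  rewrite setTI (_ : _ @^-1` _ = A m)//; apply/seteqP.
  have E y : ((nbad M%:R d (a m) y)%:R < d./2%:R / 8 :> R) = (8 * nbad M%:R d (a m) y < d./2)%N.
    by rewrite ltr_pdivlMr// mulrC -natrM ltr_nat.
  by split => y /=; rewrite in_itv/= E.
have [|D [mD DA]] := @disjoint_decoder _ _ _ (Ordinal (expn_gt0 2 k : 0 < 2 ^ k)%N) A mA.
  move=> l m y Al Am; apply/eqP; apply: contraT => lm.
  have := fsep l m lm; have := @hamming_le_nbad M _ (f l) (f m) (a l) (a m) d y erefl (aE l) (aE m).
  by move=> hbad /leq_sep/(_ hbad Al)/(_ Am).
exists a, D; split.
- move=> m; apply: admissible_slope_cov => // i; rewrite /a.
  case: insubP => [j _ _|_]; last by rewrite lexx ler01.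
  rewrite divr_ge0//= ler_pdivrMr// mul1r ler_nat; exact/ltnW.
- by move=> m; exact: mD.
- move=> l m lm; apply: finj; apply/ffunP => i; apply/val_inj/eqP.
  have := slope_cov_inj lm (ltn_ord i); rewrite !aE => /(mulIf _) h.
  by rewrite -(@eqr_nat R) h// invr_eq0 gt_eqF.
- move=> m; apply: (@le_trans _ _ (8 * (rho / 8))%:E); last by rewrite mulrC divfK.
  apply: le_trans (gaussian_many_bad e0 M0 delta0 eM (a m) d2).
  apply: le_gaussian => y /= Dm; rewrite leqNgt; apply: contra Dm => Am.
  by apply/eqP/DA.
Qed.

(** With [L = log2 kappa] and [q] the integer part of [L / 4], one has [L <= 5 q] once [q >= 4], and
    [d <= 3 d./2]. So [d L <= 15 q d./2], and the constant is [30 = 2 * 15]. *)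
Lemma exists_rate (rho : R) : 0 < rho ->
  exists2 kappa_rho : R, 8 <= kappa_rho & forall (d k : nat) (kappa : R),
    (2 <= d)%N -> kappa_rho <= kappa -> k%:R <= 30^-1 * d%:R * log2 kappa ->
    exists2 q : nat, (4 <= q)%N &
      (2 * k <= q * d./2)%N /\ 4096 * 2 ^+ q ^+ 2 <= kappa * (rho / 8) ^+ 3.
Proof.
move=> rho0; have : 0 < 4096 :> R by rewrite ltr0n.
move: (4096 : R) => c c0; set delta := rho / 8; have delta0 : 0 < delta by rewrite divr_gt0.
have l0 : 0 < ln 2 :> R by rewrite ln_gt0// ltr1n.
(* The first term gives [L >= 16], hence [q >= 4]. The second gives [c ^+ 2 <= kappa * delta ^+ 6],
   which with [2 ^ (4 q) <= kappa] is the square of the required inequality. *)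
exists (2 ^+ 16 + c ^+ 2 / delta ^+ 6) => [|d k kappa d2 kk kd].
  have : 0 <= c ^+ 2 / delta ^+ 6 by rewrite divr_ge0 ?exprn_ge0 ?ltW.
  by move: (_ / _) => z; rewrite !exprS expr0; lra.
have dd : 0 < c ^+ 2 / delta ^+ 6 by rewrite divr_gt0 ?exprn_gt0.
have k16 : 2 ^+ 16 <= kappa by apply: le_trans kk; rewrite lerDl ltW.
have kdelta : c ^+ 2 / delta ^+ 6 <= kappa by apply: le_trans kk; rewrite lerDr exprn_ge0.
have kappa0 : 0 < kappa by apply: lt_le_trans k16; rewrite exprn_gt0.
pose L := log2 kappa; pose q := Num.truncn (L / 4).
have L16 : 16 <= L.
  rewrite /L /log2 ler_pdivlMr// mulr_natl -lnXn// ler_ln ?posrE ?exprn_gt0//.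
have /truncn_itv/andP[qL Lq] : 0 <= L / 4 by rewrite divr_ge0//; lra.
have q4 : (4 <= q)%N.
  by rewrite -ltnS -(@ltr_nat R); apply: le_lt_trans Lq; rewrite ler_pdivlMr//; lra.
exists q => //; split.
  rewrite -(@ler_nat R) !natrM; apply: (@le_trans _ _ (2 * (30^-1 * d%:R * L))).
    by rewrite ler_wpM2l.
  have d3 : d%:R <= 3 * d./2%:R :> R.
    by rewrite -natrM ler_nat leq_triple_half.
  have q5 : L <= 5 * q%:R.
    by move: Lq; rewrite ltr_pdivrMr// -natr1; move: q4; rewrite -(@ler_nat R); lra.
  have : d%:R * L <= 3 * d./2%:R * (5 * q%:R) by rewrite ler_pM//; lra.
  by rewrite -mulrA; lra.
have q16 : 2 ^+ q ^+ 2 ^+ 2 <= kappa.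
  rewrite -!exprM -ler_ln ?posrE ?exprn_gt0// lnXn//.
  move: qL; rewrite /L /log2 -/q ler_pdivlMr// -(@ler_pM2r _ (ln 2))// divfK ?gt_eqF//.
  by move=> {}qL; rewrite -[leLHS]mulr_natl natrM.
have h : (c * 2 ^+ q ^+ 2) ^+ 2 <= (kappa * delta ^+ 3) ^+ 2.
  rewrite [leLHS]exprMn [leRHS]exprMn -(exprM delta) (expr2 kappa) [leRHS]mulrAC.
  apply: ler_pM => //; first exact: sqr_ge0.
  by rewrite -ler_pdivrMr ?exprn_gt0.
by rewrite -(@ler_pXn2r _ 2) ?nnegrE// mulr_ge0 ?exprn_ge0 ?ltW.
Qed.

Lemma eps_G_le (rho kappa : R) (d k q : nat) :
  0 < rho -> 8 <= kappa -> (2 <= d)%N -> (4 <= q)%N -> (2 * k <= q * d./2)%N ->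
  4096 * 2 ^+ q ^+ 2 <= kappa * (rho / 8) ^+ 3 ->
  (eps_G d k kappa <= rho%:E)%E.
Proof.
move=> rho0 k8 d2 q4 kq large.
have [a [D [codea decD _ err]]] := exists_slope_code rho0 k8 d2 q4 kq large.
apply: (@le_trans _ _ (avg_error (fun m => slope_cov kappa^-1 (a m) d) D)).
  by apply: ereal_inf_lbound; exists (fun m => slope_cov kappa^-1 (a m) d), D.
have N0 : 0 < (2 ^ k)%N%:R :> R by rewrite ltr0n expn_gt0.
apply: (@le_trans _ _ (((2 ^ k)%N%:R^-1)%:E * \sum_(m < 2 ^ k) rho%:E)%E).
  by apply: lee_wpmul2l; [rewrite lee_fin invr_ge0 ltW|apply: lee_sum => m _; exact: err].
by rewrite sumEFin sumr_const card_ord -EFinM -[rho *+ _]mulr_natl mulKf ?gt_eqF.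
Qed.

End code.

(** * Mutual information *)

Section kl_div.
Context d (T : measurableType d) (R : realType).
Local Open Scope ereal_scope.

(** Positive parts increase and negative parts decrease, which reduces the claim to
    [ge0_le_integralW]. *)
Lemma le_integralW (mu : {measure set T -> \bar R}) (f g : T -> \bar R) :
  (forall x, f x <= g x) -> \int[mu]_x f x <= \int[mu]_x g x.
Proof.
move=> fg; rewrite integralE [leRHS]integralE leeB//; apply: ge0_le_integralW => x _.
- exact: funepos_ge0.
- by rewrite !funeposE ge_max !le_max fg lexx orbT.
- exact: funeneg_ge0.
- by rewrite !funenegE ge_max !le_max leeN2 fg lexx orbT.
Qed.

(* With [f = dP/dQ] and [G = K 1_E + 1], integrate over P the inequality
   [ln f >= ln G + 1 - G / f >= (ln K) 1_E + 1 - G / f]. *)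
Lemma kl_div_ge (P Q : probability T R) (E : set T) (K : R) :
  measurable E -> (1 <= K)%R ->
  ((ln 2)^-1 * (ln K * fine (P E) - K * fine (Q E)))%:E <= kl_div P Q.
Proof.
move=> mE K1; rewrite /kl_div; case: asboolP => [PQ|_]; last exact: leey.
have K0 : (0 < K)%R by apply: lt_le_trans K1.
set c := (ln 2)^-1%R; have c0 : (0 <= c)%R by rewrite invr_ge0 ln_ge0// ler1n.
pose f := Radon_Nikodym (charge_of_finite_measure P) Q.
(* [g] is a version of [f] that is nonnegative and finite everywhere; the two agree almost
   everywhere for [Q]. *)
pose g := Radon_Nikodym_SigmaFinite.f P Q.
pose r x := fine (g x).
have gE x : g x = (r x)%:E by rewrite fineK// Radon_Nikodym_SigmaFinite.f_fin_num.
have r0 x : (0 <= r x)%R by apply: fine_ge0; exact: (Radon_Nikodym_SigmaFinite.f_ge0 PQ).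
have mg : measurable_fun setT g.
  exact: measurable_int (Radon_Nikodym_SigmaFinite.f_integrable PQ).
have mr : measurable_fun setT r.
  by apply/measurable_EFinP; apply: eq_measurable_fun mg => x _; rewrite gE.
pose G x : R := (K * \1_E x + 1 * 1)%R.
have G1 x : (1 <= G x)%R by rewrite /G mulr1 lerDr mulr_ge0// ltW.
have mG : measurable_fun setT G by apply: measurable_funD => //; exact: measurable_funM.
pose w x : R := (G x * r x `^ (-1))%R.
have wE x : w x = (G x / r x)%R by rewrite /w powR_inv1.
have mw : measurable_fun setT w.
  apply: measurable_funM => //.
  exact: (measurableT_comp (@measurable_powR R (-1)%R) mr).
have w0 x : (0 <= w x)%R by rewrite wE divr_ge0// (le_trans _ (G1 x)).
have intG : \int[Q]_x (G x)%:E = (K * fine (Q E) + 1)%:E.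
  rewrite ge0_integral_lincomb//; last by rewrite ltW.
  rewrite integral_indic// setIT integral_cst// !mul1e.
  rewrite [X in _ + X](probability_setT Q).
  by rewrite EFinD EFinM fineK ?fin_num_measure.
(* Changing measure turns [G / g] against P into [G] against Q, except where [g = 0]: there the
   inverse is 0 and the integrand only drops. *)
have intw : \int[P]_x (w x)%:E <= (K * fine (Q E) + 1)%:E.
  rewrite -intG -(Radon_Nikodym_SigmaFinite.change_of_variables PQ)//; last first.
    exact/measurable_EFinP.
  apply: ge0_le_integralW => x _.
    by rewrite mule_ge0 ?lee_fin// Radon_Nikodym_SigmaFinite.f_ge0.
  rewrite -/(g x) gE -EFinM lee_fin wE.
  have [->|rx0] := eqVneq (r x) 0%R; last by rewrite divfK.
  by rewrite mulr0 (le_trans _ (G1 x)).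
have [N [mN QN fgN]] := ae_eq_Radon_Nikodym_SigmaFinite PQ measurableT.
(* The P-null set where [f] and [g] may differ or [g] vanishes. Giving [h'] the value [-oo] there
   makes the lower bound hold everywhere. *)
pose Z := N `|` [set x | g x <= 0].
have mg0 : measurable [set x | g x <= 0].
  by rewrite -[X in measurable X]setTI; exact: emeasurable_fun_infty_c.
have mZ : measurable Z by exact: measurableU.
have PN : P N = 0 by have /null_content_dominatesP := PQ; apply.
have Pg0 : P [set x | g x <= 0] = 0.
  rewrite (Radon_Nikodym_SigmaFinite.f_integral PQ)//; apply: integral0_eq => x /= gx0.
  by apply/eqP; rewrite eq_le gx0 Radon_Nikodym_SigmaFinite.f_ge0.
have PZ : P Z = 0 by rewrite measureU0.
pose u x : R := (c * ln K * \1_E x + c * 1)%R.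
pose h x := (u x)%:E - (c * w x)%:E.
pose h' x := if x \in Z then -oo else h x.
have mu' : measurable_fun setT u by apply: measurable_funD => //; exact: measurable_funM.
have mcw : measurable_fun setT (fun x => c * w x)%R by exact: measurable_funM.
have mh : measurable_fun setT h.
  by apply: emeasurable_funB; exact/measurable_EFinP.
have h'f x : h' x <= log2e (f x).
  rewrite /h'; case: ifPn => [_|/negP xZ]; first exact: leNye.
  have {}xZ : ~ Z x by move=> /mem_set.
  have rx : (0 < r x)%R.
    by rewrite ltNge; apply/negP => rx; apply: xZ; right; rewrite /= gE lee_fin.
  have -> : f x = g x.
    by apply/esym; apply: contrapT => fg; apply: xZ; left; apply: fgN => /(_ I).
  rewrite gE /log2e lne_EFin// -EFinM /h -EFinB lee_fin /u -!mulrA -mulrDr -mulrBr.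
  rewrite [leRHS]mulrC ler_wpM2l// wE.
  have : (ln (G x / r x) <= G x / r x - 1)%R.
    have := @le_ln1Dx R (G x / r x - 1)%R; rewrite (addrC 1%R) subrK; apply.
    by rewrite ltrBDr addNr divr_gt0// (lt_le_trans _ (G1 x)).
  rewrite ln_div ?posrE ?(lt_le_trans _ (G1 x))//.
  have : (ln K * \1_E x <= ln (G x))%R.
    rewrite /G indicE; case: (x \in E); rewrite ?mulr0 ?add0r ?mulr1 ?ln1//.
    by rewrite ler_ln ?posrE ?addr_gt0// lerDl.
  by lra.
apply: (@le_trans _ _ (\int[P]_x h' x)); last exact: le_integralW.
have lnK0 : (0 <= ln K)%R by rewrite ln_ge0.
have u0 x : (0 <= u x)%R by rewrite addr_ge0// !mulr_ge0.
have intu : \int[P]_x (u x)%:E = (c * ln K * fine (P E) + c)%:E.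
  rewrite ge0_integral_lincomb ?mulr_ge0//.
  rewrite integral_indic// setIT integral_cst// !mul1e.
  rewrite [X in _ + _ * X](probability_setT P) mule1.
  by rewrite [RHS]EFinD [in RHS]EFinM fineK ?fin_num_measure.
have intcw : \int[P]_x (c * w x)%:E <= (c * (K * fine (Q E) + 1))%:E.
  under eq_integral do rewrite EFinM.
  rewrite ge0_integralZl_EFin//; last 2 first.
  - by move=> x _; rewrite lee_fin.
  - exact/measurable_EFinP.
  by rewrite EFinM lee_wpmul2l.
have integrable_nneg (v : T -> R) : measurable_fun setT v -> (forall x, 0 <= v x)%R ->
    \int[P]_x (v x)%:E < +oo -> P.-integrable setT (EFin \o v).
  move=> mv v0 v_lty; apply/integrableP; split; first exact/measurable_EFinP.
  by under eq_integral do rewrite /= ger0_norm//.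
have -> : \int[P]_x h' x = \int[P]_x h x.
  apply: ae_eq_integral => //.
  - apply: measurable_fun_ifT => //; apply: (measurable_fun_bool true).
    rewrite setTI (_ : _ @^-1` _ = Z)//; apply/seteqP.
    by split => x /=; [exact: set_mem|exact: mem_set].
  - exists Z; split => // x /= xZ; apply: contrapT => nZ; apply: xZ => _.
    by rewrite /h' memNset.
rewrite integralB//; last 2 first.
- by apply: integrable_nneg => //; rewrite intu ltry.
- apply: (integrable_nneg (fun x => c * w x)%R) => //; last exact: le_lt_trans intcw (ltry _).
  by move=> x; rewrite mulr_ge0.
rewrite intu; apply: le_trans (leeB (lexx _) intcw).
by rewrite -EFinB lee_fin; lra.
Qed.

End kl_div.

(** * Uniform mixtures of finitely many laws *)

Section mixture.
Context d (T : measurableType d) (R : realType) (n : nat).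
Variable mu : 'I_n.+1 -> probability T R.
Local Open Scope ereal_scope.

Let weight : {nonneg R} := (n.+1%:R^-1)%:nng%R.

Definition mixture : set T -> \bar R :=
  mscale weight (msum (fun i => mu (inord i)) n.+1).

HB.instance Definition _ := Measure.on mixture.

Lemma mixtureE A : mixture A = (n.+1%:R^-1)%:E * \sum_(i < n.+1) mu i A.
Proof.
rewrite /mixture /mscale /msum/=; congr (_ * _).
by apply: eq_bigr => i _; rewrite inord_val.
Qed.

Let mixture_setT : mixture setT = 1.
Proof.
rewrite mixtureE (eq_bigr (fun=> 1)) => [|i _]; last exact: probability_setT.
by rewrite sumEFin sumr_const card_ord -EFinM mulVf// pnatr_eq0.
Qed.

HB.instance Definition _ := Measure_isProbability.Build _ _ _ mixture mixture_setT.

Lemma ge0_integral_mixture (f : T -> \bar R) :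
  measurable_fun setT f -> (forall x, 0 <= f x) ->
  \int[mixture]_x f x = (n.+1%:R^-1)%:E * \sum_(i < n.+1) \int[mu i]_x f x.
Proof.
move=> mf f0; rewrite ge0_integral_mscale// ge0_integral_measure_sum//.
by congr (_ * _); apply: eq_bigr => i _; rewrite inord_val.
Qed.

End mixture.

Section dirac_mixture.
Context d (T : measurableType d) (R : realType) (n : nat).
Hypothesis measurable_set1T : forall x : T, measurable [set x].
Variable c : 'I_n.+1 -> T.
Local Open Scope ereal_scope.

Import HBNNSimple.

(* To be applied to [S |-> gaussian S B], whose Borel measurability is not
   established here. *)
Lemma ge0_integral_dirac_mixture (f : T -> \bar R) : (forall x, 0 <= f x) ->
  \int[mixture (fun i => \d_(c i) : probability T R)]_x f x =
  (n.+1%:R^-1)%:E * \sum_(i < n.+1) f (c i).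
Proof.
move=> f0; set nu := mixture _.
have int_nu g : measurable_fun setT g -> (forall x, 0 <= g x) ->
    \int[nu]_x g x = (n.+1%:R^-1)%:E * \sum_(i < n.+1) g (c i).
  move=> mg g0; rewrite ge0_integral_mixture//; congr (_ * _).
  by apply: eq_bigr => i _; rewrite integral_dirac// diracT mul1e.
have w0 : 0 <= (n.+1%:R^-1)%:E :> \bar R by rewrite lee_fin.
apply/eqP; rewrite eq_le; apply/andP; split.
  (* Upper bound: every simple function below [f] is measurable, so its integral is the average over
     the atoms. *)
  rewrite ge0_integralTE//; apply: ge_ereal_sup => _ [h hf <-].
  have -> : sintegral nu h = \int[nu]_x (h x)%:E.
    by rewrite integral_nnsfun// patch_setT.
  rewrite int_nu//; [|exact/measurable_EFinP|by move=> x; rewrite lee_fin].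
  by rewrite lee_wpmul2l// lee_sum.
(* Lower bound: [F] is the set of atoms, and [f] restricted to it is measurable. *)
pose F := \bigcup_i [set c (inord i)].
have mF : measurable F by exact: bigcupT_measurable.
have cF i : F (c i) by exists i => //=; rewrite inord_val.
have mfF : measurable_fun setT (f \_ F).
  apply/(measurable_restrictT _ _).1 => //.
  by apply/measurable_fun_bigcup => // i; exact: measurable_fun_set1.
have fF0 x : 0 <= (f \_ F) x by exact: erestrict_ge0.
apply: (@le_trans _ _ (\int[nu]_x (f \_ F) x)).
  rewrite int_nu// lee_wpmul2l// lee_sum// => i _.
  by rewrite patchE mem_set.
apply: ge0_le_integralW => x _ //.
by rewrite patchE; case: ifP.
Qed.

End dirac_mixture.

Lemma dirac_product d1 d2 (X : measurableType d1) (Y : measurableType d2)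
    (R : realType) (x : X) (nu : probability Y R) (A : set X) (B : set Y) :
  measurable A -> measurable B ->
  (((\d_x : probability X R) \x nu) (A `*` B) = (x \in A)%:R%:E * nu B)%E.
Proof. by move=> mA mB; rewrite product_measure1E. Qed.

Section gaussian_prob.
Context (R : realType) (d : nat) (S : 'M[R]_d).
Hypothesis S1 : (\int[lebesgue_rvec R d]_y (gaussian_pdf S y)%:E = 1)%E.
Local Open Scope ereal_scope.

(** The proof of total mass 1 is an argument, so that the probability structure can be attached to
    the resulting term. *)
Definition gaussian_prob of (\int[lebesgue_rvec R d]_y (gaussian_pdf S y)%:E = 1)
  : set (rvec R d) -> \bar R := gaussian S.
Local Notation mu := (gaussian_prob S1).

Let mu0 : mu set0 = 0.
Proof. by rewrite /gaussian_prob /gaussian integral_set0. Qed.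

Let mu_ge0 A : 0 <= mu A.
Proof. by apply: integral_ge0 => x _; rewrite lee_fin gaussian_pdf_ge0. Qed.

Let mu_sigma_additive : semi_sigma_additive mu.
Proof.
move=> A mA tA mUA; rewrite /gaussian_prob /gaussian/= ge0_integral_bigcup//=.
- apply: is_cvg_ereal_nneg_natsum_cond => n _ _.
  by apply: integral_ge0 => x _; rewrite lee_fin gaussian_pdf_ge0.
- apply/measurable_funTS/measurable_EFinP; exact: measurable_gaussian_pdf.
- by move=> x _; rewrite lee_fin gaussian_pdf_ge0.
Qed.

HB.instance Definition _ := isMeasure.Build _ _ _ mu mu0 mu_ge0 mu_sigma_additive.

Let mu_setT : mu setT = 1. Proof. exact: S1. Qed.

HB.instance Definition _ := Measure_isProbability.Build _ _ _ mu mu_setT.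

End gaussian_prob.

Lemma measurable_set1_borel_mx (R : realType) d (A : borel_mx R d) :
  measurable [set A].
Proof.
have cA : closed [set A : 'M[R]_d].
  exact/accessible_closed_set1/hausdorff_accessible/norm_hausdorff.
rewrite -[X in measurable X]setCK; apply: measurableC.
by apply: sub_sigma_algebra; exact: closed_openC.
Qed.

(** * From a code to a lower bound on capacity *)

Section capacity.
Context (R : realType) (d n : nat).
Local Open Scope ereal_scope.

(** [E] is the event of correct decoding, of joint probability at least [1 - rho]. Under the product
    of the marginals each [c i] has mass [1 / n.+1], by injectivity of [c], so [E] has mass at most
    [1 / n.+1]. Then [kl_div_ge] applies with [K = n.+1]. *)
Lemma mixture_mutual_info_ge (rho : R) (c : 'I_n.+1 -> borel_mx R d)
    (mu : 'I_n.+1 -> probability (rvec R d) R) (D : rvec R d -> 'I_n.+1) :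
  injective c -> (forall i, measurable (D @^-1` [set i])) ->
  (forall i, mu i [set y | D y != i] <= rho%:E) ->
  ((ln 2)^-1 * (ln n.+1%:R * (1 - rho) - 1))%:E <=
  mutual_info (mixture (fun i => (\d_(c i) : probability _ R) \x mu i
     : probability (borel_mx R d * rvec R d)%type R)).
Proof.
move=> cinj mD err; set P := mixture _.
have w0 : 0 <= (n.+1%:R^-1)%:E :> \bar R by rewrite lee_fin.
have mc i : measurable [set c i] by exact: measurable_set1_borel_mx.
pose G i := [set c i] `*` (D @^-1` [set i]).
have mG i : measurable (G i) by exact: measurableX.
pose E := \big[setU/set0]_(i < n.+1) G i.
have mE : measurable E by exact: bigsetU_measurable.
have PE : (1 - rho)%:E <= P E.
  rewrite [P E]mixtureE.
  apply: (@le_trans _ _ ((n.+1%:R^-1)%:E * \sum_(i < n.+1) (1 - rho)%:E)).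
    by rewrite sumEFin sumr_const card_ord -EFinM -[((1 - rho) *+ _)%R]mulr_natl mulKf// pnatr_eq0.
  rewrite lee_wpmul2l//; apply: lee_sum => i _.
  apply: (@le_trans _ _ (((\d_(c i) : probability _ R) \x mu i) (G i))); last first.
    by apply: le_measure; rewrite ?inE// /E (bigD1 i)//=; exact: subsetUl.
  rewrite dirac_product// mem_set// mul1e.
  have -> : D @^-1` [set i] = ~` [set y | D y != i].
    by apply/seteqP; split => y /= => [->|/negP/negPn/eqP//]; rewrite eqxx.
  have mC : measurable [set y | D y != i].
    rewrite (_ : [set y | _] = ~` (D @^-1` [set i])); first exact: measurableC.
    by apply/seteqP; split => y /= => [/eqP//|h]; apply/eqP.
  by rewrite probability_setC// EFinB leeB.
have QE : (marginals_product P E <= (n.+1%:R^-1)%:E).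
  rewrite measure_bigsetU_ord_cond//; last first.
    move=> i j _ _ [[x y] [/= [_ yi] [_ yj]]].
    by move: yi yj => /= -> ->.
  rewrite (eq_bigr (fun i => (n.+1%:R^-1)%:E * distribution P snd (D @^-1` [set i]))).
    rewrite -ge0_sume_distrr// -[leRHS]mule1 lee_wpmul2l//.
    rewrite -measure_bigsetU_ord_cond//; first by apply: probability_le1; exact: bigsetU_measurable.
    by move=> i j _ _ [y /= [-> ->]].
  move=> i _; rewrite [LHS]product_measure1E//; congr (_ * _).
  rewrite /distribution /pushforward [LHS]mixtureE (bigD1 i)//= big1 => [|j ji].
    rewrite adde0 (_ : _ @^-1` _ = [set c i] `*` setT); last first.
      by apply/seteqP; split => -[x y] //= [].
    by rewrite dirac_product// mem_set// mul1e probability_setT mule1.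
  rewrite (_ : _ @^-1` _ = [set c i] `*` setT); last first.
    by apply/seteqP; split => -[x y] //= [].
  rewrite dirac_product// memNset ?mul0e// => /= cji.
  by rewrite (cinj _ _ cji) eqxx in ji.
have K1 : (1 <= n.+1%:R :> R)%R by rewrite ler1n.
apply: le_trans (kl_div_ge P (marginals_product P) mE K1).
rewrite lee_fin ler_wpM2l ?invr_ge0 ?ln_ge0 ?ler1n// lerB// ?ler_wpM2l ?ln_ge0//.
- by rewrite -lee_fin fineK ?fin_num_measure.
- by rewrite -ler_pdivlMl ?ltr0n// mulr1 -lee_fin fineK ?fin_num_measure.
Qed.

Lemma capacity_ge (rho kappa : R) (c : 'I_n.+1 -> 'M[R]_d) (D : rvec R d -> 'I_n.+1) :
  (forall i, admissible kappa (c i)) -> injective c ->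
  (forall i, \int[lebesgue_rvec R d]_y (gaussian_pdf (c i) y)%:E = 1) ->
  (forall i, measurable (D @^-1` [set i])) ->
  (forall i, gaussian (c i) [set y | D y != i] <= rho%:E) ->
  ((ln 2)^-1 * (ln n.+1%:R * (1 - rho) - 1))%:E <= capacity d kappa.
Proof.
move=> cadm cinj c1 mD err.
pose mu i : probability (rvec R d) R := gaussian_prob (c1 i).
apply: (le_trans (@mixture_mutual_info_ge rho c mu D cinj mD err)).
apply: ereal_sup_ubound.
exists (mixture (fun i => \d_(c i : borel_mx R d) : probability (borel_mx R d) R)).
eexists; split; last reflexivity.
- rewrite /is_prior [LHS]mixtureE (eq_bigr (fun=> 1)) => [|i _].
    by rewrite sumEFin sumr_const card_ord -EFinM mulVf// pnatr_eq0.
  transitivity ((c i \in [set S | admissible kappa S])%:R%:E : \bar R); first exact: diracE.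
  by rewrite mem_set//; exact: cadm.
- move=> A B mA mB; rewrite [LHS]mixtureE integral_mkcond.
  rewrite ge0_integral_dirac_mixture; last 2 first.
  + exact: measurable_set1_borel_mx.
  + apply: erestrict_ge0 => S _; apply: integral_ge0 => y _.
    by rewrite lee_fin gaussian_pdf_ge0.
  congr (_ * _); apply: eq_bigr => i _; rewrite [LHS]dirac_product// patchE.
  by case: ifP => _; rewrite ?mul1e ?mul0e.
Qed.

End capacity.

Theorem theorem5 (R : realType) :
  (forall rho : R, 0 < rho < 1 ->
     exists c_rho kappa_rho : R, 0 < c_rho /\
       forall (d : nat) (kappa : R), (2 <= d)%N -> 1 <= kappa ->
         kappa_rho <= kappa ->
         forall k : nat, k%:R <= c_rho * d%:R * log2 kappa ->
           (eps_G d k kappa <= rho%:E)%E) /\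
  (exists c kappa0 : R, 0 < c /\
     forall (d : nat) (kappa : R), (2 <= d)%N -> 1 <= kappa ->
       kappa0 <= kappa ->
       ((c * d%:R * log2 kappa)%:E <= capacity d kappa)%E).
Proof.
split.
  move=> rho /andP[rho0 _]; have [kr kr8 rate] := exists_rate rho0.
  (* The rate constant is the same for every [rho]; only the threshold depends on it. *)
  exists 30^-1, kr; split; first by rewrite invr_gt0.
  move=> d kappa d2 _ kk k hk; have [q q4 [kq large]] := rate d k kappa d2 kk hk.
  exact: eps_G_le rho0 (le_trans kr8 kk) d2 q4 kq large.
have h0 : 0 < 2^-1 :> R by rewrite invr_gt0.
have l0 : 0 < ln 2 :> R by rewrite ln_gt0// ltr1n.
have [kr kr8 rate] := exists_rate h0.
(* At error 1/2 the bound is [k / 2 - 1 / ln 2], with [k > d L / 30 - 1]. The exponential forces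
   [L >= 60 (1/2 + 1 / ln 2)], so for [d >= 2] the loss [1/2 + 1 / ln 2] is at most half of
   [d L / 60]. *)
exists 120^-1, (kr + expR (30 * ln 2 + 60)); split; first by rewrite invr_gt0.
move=> d kappa d2 k1 kk.
have kk' : kr <= kappa by apply: le_trans kk; rewrite lerDl expR_ge0.
have kappa0 : 0 < kappa by apply: lt_le_trans k1.
have lnk : 30 * ln 2 + 60 <= ln kappa.
  rewrite -ler_expR lnK ?posrE//; apply: le_trans kk; rewrite lerDr.
  by apply: le_trans kr8.
set L := log2 kappa.
have L0 : 0 <= L by rewrite divr_ge0 ?(ltW l0) ?ln_ge0.
pose k := Num.truncn (30^-1 * d%:R * L).
have /truncn_itv/andP[] : 0 <= 30^-1 * d%:R * L by rewrite mulr_ge0// mulr_ge0 ?invr_ge0.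
rewrite -/k -[k.+1%:R]natr1 => kL Lk.
have [q q4 [kq large]] := rate d k kappa d2 kk' kL.
have [a [D [codea decD inja err]]] :=
  exists_slope_code h0 (le_trans kr8 kk') d2 q4 kq large.
have int1 m := @integral_gaussian_pdf_slope_cov R kappa^-1
  ltac:(by rewrite invr_gt0) d (a m).
apply: (@le_trans _ _ ((ln 2)^-1 * (ln (2 ^ k)%N%:R * (1 - 2^-1) - 1))%:E); last first.
  rewrite /is_code in codea; rewrite /is_decoder in decD.
  (* [2 ^ k] is generalized to a successor, the form in which [capacity_ge] counts messages. *)
  move: a D codea decD inja err int1; have : (0 < 2 ^ k)%N by rewrite expn_gt0.
  case: (2 ^ k)%N => // n _ a D codea decD inja err int1.
  exact: (capacity_ge codea inja int1 decD err).
rewrite lee_fin natrX lnXn// -[ln 2 *+ k]mulr_natl.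
rewrite (_ : _ * (_ - 1) = k%:R * (1 - 2^-1) - (ln 2)^-1); last by field; rewrite gt_eqF.
have : 60 * (2^-1 + (ln 2)^-1) <= L.
  rewrite ler_pdivlMr// (_ : _ * _ = 30 * ln 2 + 60)//.
  by field; rewrite gt_eqF.
have : 2 * L <= d%:R * L by rewrite ler_wpM2r// ler_nat.
move: Lk; rewrite -!mulrA.
by move: (d%:R * L) ((ln 2)^-1) => x y; lra.
Qed.
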